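(* Let $G \curvearrowright X$ be a free Borel action of a non-discrete non-compact locally compact second countable group $G$ on a standard Borel space $X$. Let $\Gamma \le G$ be a countable dense subgroup and let $\mathcal{C} \subseteq X$ be a lacunary cross-section such that $\rho(E_{\mathcal{C}}) \subseteq \Gamma$. Then there exists a lacunary Borel separating cross-section $\mathcal{D} \supseteq \mathcal{C}$ such that $\rho(E_{\mathcal{D}}) \subseteq \Gamma$.
   Context: Let $E_{G}$ be the orbit equivalence relation of the free action $G \curvearrowright X$, and let $\rho : E_{G} \to G$ be the cocycle determined by $\rho(x,y) \cdot x = y$. A (Borel) cross-section is a Borel set $\mathcal{C} \subseteq X$ that meets every orbit of the action and is such that $\{g \in G : g^{-1}x \in \mathcal{C}\}$ is a (closed) discrete subset of $G$ for every $x \in X$. For a cross-section $\mathcal{C}$, $E_{\mathcal{C}}$ denotes the restriction of $E_{G}$ to $\mathcal{C}$, so $\rho(E_{\mathcal{C}}) = \{\rho(x,y) : x,y \in \mathcal{C},\ x E_{G} y\}$. Given $U \subseteq G$, a cross-section $\mathcal{C}$ is $U$-lacunary if $(U \cdot x) \cap (U \cdot y) = \varnothing$ for all distinct $x,y \in \mathcal{C}$; it is lacunary if it is $U$-lacunary for some neighborhood $U$ of the identity of $G$. With a cross-section $\mathcal{C}$ one associates the map $\phi$ from $X$ to the space of closed discrete subsets of $G$ given by $\phi(x) = \{g \in G : g^{-1}x \in \mathcal{C}\}$. The cross-section $\mathcal{C}$ is separating if $\phi$ is injective. *)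

(* Defs.v *)
From HB Require Import structures.
From mathcomp Require Import all_boot all_order all_algebra.
From mathcomp Require Import all_classical all_reals all_analysis.

Set Implicit Arguments.
Unset Strict Implicit.
Unset Printing Implicit Defensive.

Local Open Scope classical_set_scope.
Local Open Scope group_scope.

HB.mixin Record isTopologicalGroup G & Topological G & Group G := {
  mulg_continuous : continuous (fun p : G * G => p.1 * p.2);
  invg_continuous : continuous (fun g : G => g^-1)
}.

#[short(type="topologicalGroupType")]
HB.structure Definition TopologicalGroup :=
  {G of Topological G & Group G & isTopologicalGroup G}.

Definition discrete_group (G : topologicalGroupType) : Prop :=
  forall A : set G, open A.

(** [borel_group G] is [G] as a measurable space with its Borel sets.  The
    library requires measurable spaces to be pointed, whence the alias of [G]
    pointed by the identity. *)

Definition pointed_group (G : topologicalGroupType) : Type := G.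

HB.instance Definition _ (G : topologicalGroupType) :=
  Choice.on (pointed_group G).
HB.instance Definition _ (G : topologicalGroupType) :=
  isPointed.Build (pointed_group G) (1 : G).

Notation borel_group G :=
  (@g_sigma_algebraType (pointed_group G) (@open G)).

#[short(type="completeMetricType")]
HB.structure Definition CompleteMetric (R : numDomainType) :=
  {T of Metric R T & Complete T}.

Definition separable (T : topologicalType) : Prop :=
  exists2 A : set T, countable A & dense A.

Definition standard_borel (R : realType) d (X : measurableType d) : Prop :=
  exists2 P : completeMetricType R, separable P &
  exists2 f : X -> P, bijective f &
    forall A : set X, measurable A <-> (<<s @open P >>) (f @` A).

Section Actions.
Variables (G : topologicalGroupType) (d : measure_display)
  (X : measurableType d) (act : G -> X -> X).

Definition group_action : Prop :=
  (forall x, act 1 x = x) /\ (forall g h x, act (g * h) x = act g (act h x)).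

Definition free_action : Prop := forall g x, act g x = x -> g = 1.

Definition borel_action : Prop :=
  measurable_fun [set: borel_group G * X]
    (fun p : borel_group G * X => act p.1 p.2).

Definition orbit_equiv : set (X * X) := [set p | exists g, act g p.1 = p.2].

Definition orbit_equiv_on (C : set X) : set (X * X) :=
  orbit_equiv `&` (C `*` C).

(** Junk value [1] outside [orbit_equiv]; for a free action the element is
    unique, see [cocycle_unique]. *)
Definition cocycle (p : X * X) : G := xget 1 [set g | act g p.1 = p.2].

Lemma cocycleP p : orbit_equiv p -> act (cocycle p) p.1 = p.2.
Proof.
by move=> [g gp]; rewrite /cocycle; case: xgetP => [_ _ //|/(_ g)].
Qed.

Lemma cocycle_unique : group_action -> free_action ->
  forall g x, cocycle (x, act g x) = g.
Proof.
move=> [act1 actM] fr g x.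
have /cocycleP/= E : orbit_equiv (x, act g x) by exists g.
have /fr c1 : act (g^-1 * cocycle (x, act g x)) x = x.
  by rewrite actM E -actM mulVg act1.
by rewrite -[LHS](mulVKg g) c1 mulg1.
Qed.

Definition closed_discrete (A : set G) : Prop := closed A /\ A `<=` isolated A.

Definition visits (C : set X) (x : X) : set G := [set g | C (act g^-1 x)].

Definition cross_section (C : set X) : Prop :=
  [/\ measurable C,
      forall x, exists2 y, C y & orbit_equiv (x, y)
    & forall x, closed_discrete (visits C x)].

Definition translates (U : set G) (x : X) : set X := [set act g x | g in U].

Definition lacunary_for (U : set G) (C : set X) : Prop :=
  forall x y, C x -> C y -> x <> y -> translates U x `&` translates U y = set0.

Definition lacunary (C : set X) : Prop :=
  exists2 U : set G, nbhs (1 : G) U & lacunary_for U C.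

Definition separating (C : set X) : Prop := injective (visits C).

End Actions.

(* Main.v *)
Require Import Defs.
From HB Require Import structures.
From mathcomp Require Import all_boot all_order all_algebra.
From mathcomp Require Import all_classical all_reals all_analysis.

(** The idea is to write, next to each point of a large cross-section, enough
    information to recover the point from the way its orbit meets the new
    cross-section.

    First enlarge [C], inside [Gamma . C], to a lacunary [A] that meets
    [K . x] for every [x] and a fixed compact [K] ([syndetic_extension]): since
    [Gamma] is dense, a maximal lacunary subset of [Gamma . C] containing [C]
    will do.  Points of [Gamma . C] in one orbit differ by elements of [Gamma],
    since those of [C] do, so the condition on the cocycle is automatic for
    subsets of [Gamma . C].

    Let [B m] be countably many Borel sets separating the points of [X].  As
    [G] is not compact, [A] contains infinitely many disjoint subsets [E n],
    each of which meets [K n . x] for every [x] and a compact [K n]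
    ([disjoint_large_parts]).  A point [x] of [E n] records, for the finitely
    many points of [A] in [(K n)^-1 . x] and for all [m <= n], which of these
    points lie in [B m].  This is finite information, hence a label
    [f x : nat]; and every bit [B m y] of every [y] in [A] is recorded at some
    point of [E m].  So the visits of an orbit to [A] together with their
    labels determine a point of [A] ([separating_labels]).

    Finally the labels are turned into positions ([coded_section]).  As [G] is
    not discrete and [Gamma] is dense, there are [delta] in [Gamma] and an
    injective sequence [gamma i] in [Gamma], all small, with the [gamma i] much
    closer to [1] than [delta] is, but bounded away from [1].  Replace each [c]
    in [A] by the three points [c], [delta c] and [gamma (f c) c].  The result
    [D] is lacunary, and both [A] and [f] can be read off from [D], because
    [delta c] is the outlier of each triple.  Hence [D] is separating. *)

Set Implicit Arguments.
Unset Strict Implicit.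
Unset Printing Implicit Defensive.

Import Order.TTheory GRing.Theory Num.Theory.
Local Open Scope classical_set_scope.

(** * Neighborhoods and compact sets in topological groups *)

Section TopologicalGroups.
Context {G : topologicalGroupType}.
Local Open Scope group_scope.
Implicit Types (a g h : G) (K L Q U : set G).

Lemma mulg_left_continuous a : continuous (fun g : G => a * g).
Proof.
move=> g; apply: (@cvg_comp _ _ _ (fun h => (a, h)) (fun p => p.1 * p.2) _
  (nbhs (a, g))); last exact: (@mulg_continuous G (a, g)).
by apply: cvg_pair; [exact: cvg_cst | exact: cvg_id].
Qed.

Lemma mulg_right_continuous a : continuous (fun g : G => g * a).
Proof.
move=> g; apply: (@cvg_comp _ _ _ (fun h => (h, a)) (fun p => p.1 * p.2) _
  (nbhs (g, a))); last exact: (@mulg_continuous G (g, a)).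
by apply: cvg_pair; [exact: cvg_id | exact: cvg_cst].
Qed.

Lemma nbhs_divg Q g : nbhs (1 : G) Q -> nbhs g [set h | Q (h * g^-1)].
Proof.
by move=> Q1; apply: (mulg_right_continuous (a := g^-1)); rewrite mulgV.
Qed.

Lemma nbhs_ldivg Q g : nbhs (1 : G) Q -> nbhs g [set h | Q (h^-1 * g)].
Proof.
move=> Q1; apply: (@invg_continuous G g [set h | Q (h * g)]).
by apply: (mulg_right_continuous (a := g)); rewrite mulVg.
Qed.

Lemma nbhs_sqrt Q : nbhs (1 : G) Q ->
  exists O, [/\ nbhs (1 : G) O, forall a, O a -> O a^-1
    & forall a b, O a -> O b -> Q (a * b)].
Proof.
move=> Q1.
have [[A B]/= [A1 B1] AB] : nbhs (1 : G, 1 : G) [set p | Q (p.1 * p.2)].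
  by apply: (@mulg_continuous G (1, 1)); rewrite /= mulg1.
pose O := A `&` B.
have O1 : nbhs (1 : G) O by apply: filterI.
exists (O `&` [set a | O a^-1]); split.
- apply: filterI => //; apply: (@invg_continuous G 1); by rewrite invg1.
- by move=> a [Oa Oa']; split => //=; rewrite invgK.
- by move=> a b [[Aa _] _] [[_ Bb] _]; apply: (AB (a, b)).
Qed.

Lemma compact_mulg K L : compact K -> compact L ->
  compact [set p.1 * p.2 | p in K `*` L].
Proof.
move=> cK cL; apply: (continuous_compact (f := fun p : G * G => p.1 * p.2)).
  by apply: continuous_subspaceT; exact: mulg_continuous.
exact: compact_setX.
Qed.

Lemma compact_invg K : compact K -> compact [set g^-1 | g in K].
Proof.
apply: (continuous_compact (f := fun g : G => g^-1)).
by apply: continuous_subspaceT; exact: invg_continuous.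
Qed.

Lemma compact_mulg_right K a : compact K -> compact [set g * a | g in K].
Proof.
apply: continuous_compact.
by apply: continuous_subspaceT; exact: mulg_right_continuous.
Qed.

Lemma compact_nbhs1 : locally_compact [set: G] ->
  exists2 K : set G, compact K & nbhs (1 : G) K.
Proof.
move=> /(_ 1 I)[B B1 [cB _]]; exists B => //.
have {}B1 : nbhs (1 : G) [set g | [set: G] g -> B g] by exact: B1.
by apply: filterS B1 => g; apply.
Qed.

Lemma not_discrete_nbhs1 U : ~ discrete_group G -> nbhs (1 : G) U ->
  exists2 g, U g & g <> 1.
Proof.
move=> ndG U1; apply: contrapT => nU; apply: ndG => A.
rewrite openE => g Ag; apply: filterS (nbhs_divg g U1) => h Uh.
suff : h * g^-1 = 1 by move/divg1_eq ->.
by apply: contrapT => ?; apply: nU; exists (h * g^-1).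
Qed.

Lemma nbhs_avoid a : hausdorff_space G -> a <> 1 ->
  nbhs (1 : G) [set g | g <> a].
Proof.
move=> hG a1; have /accessible_closed_set1/(_ a) := hausdorff_accessible hG.
by rewrite -openC openE; apply => /esym.
Qed.

Lemma dense_nbhs (S : set G) U g : dense S -> nbhs g U -> exists2 h, S h & U h.
Proof.
move=> dS; rewrite nbhsE => -[V [oV Vg] VU].
by have [h [Vh Sh]] := dS V (ex_intro _ _ Vg) oV; exists h => //; exact: VU.
Qed.

(** Otherwise [S] meets [U] in a finite, hence closed, set [F]; as [g] is not
    isolated, removing [F] from [U] leaves a nonempty open set, which must meet
    the dense set [S]. *)
Lemma dense_nbhs_sequence (S : set G) U g : hausdorff_space G ->
  ~ discrete_group G -> dense S -> nbhs g U ->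
  exists2 s : nat -> G, injective s & forall n, S (s n) /\ U (s n).
Proof.
move=> hG ndG dS Ug.
have /infiniteP/(@pcard_leP _ (pointed_group G))[s] : infinite_set (S `&` U).
  move=> finF; pose F := S `&` U.
  have clF A : A `<=` F -> closed A.
    move=> AF; apply: (accessible_finite_set_closed.1
      (hausdorff_accessible hG)).
    exact: sub_finite_set AF finF.
  have Wg : nbhs g (U^° `&` ~` (F `\ g)).
    apply: filterI; first exact: nbhs_interior.
    apply: open_nbhs_nbhs; split; last by move=> [_ /(_ erefl)].
    by apply: closed_openC; apply: clF => x [].
  have /(not_discrete_nbhs1 ndG)[h Wh h1] :
      nbhs (1 : G) [set h | (U^° `&` ~` (F `\ g)) (h * g)].
    by apply: (mulg_right_continuous (a := g)); rewrite mul1g.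
  have Fh : ~ F (h * g).
    move=> Fh; apply: Wh.2; split => // /(congr1 (fun x => x * g^-1)).
    by rewrite mulgK mulgV.
  have [||k [[Uk Fk] Sk]] := dS (U^° `&` ~` F).
  - by exists (h * g); split => //; exact: Wh.1.
  - apply: openI; first exact: open_interior.
    by apply: closed_openC; exact: clF.
  - by apply: Fk; split => //; exact: interior_subset.
exists s; first by move=> m n /inj; apply; rewrite inE.
by move=> n; exact: (@funS _ _ _ _ s n I).
Qed.

End TopologicalGroups.

(** * Countable operations on Borel sets *)

Lemma bigcup_countable_measurable d (X : measurableType d) I (T : set I)
    (F : I -> set X) : countable T -> (forall i, T i -> measurable (F i)) ->
  measurable (\bigcup_(i in T) F i).
Proof.
move=> cT mF; rewrite bigcup_set_type; apply: countable_bigcupT_measurable.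
  by rewrite (eq_countable (card_setT _)).
by case=> i Ti; apply: mF; exact: set_mem Ti.
Qed.

Lemma bigcap_countable_measurable d (X : measurableType d) I (T : set I)
    (F : I -> set X) : countable T -> (forall i, T i -> measurable (F i)) ->
  measurable (\bigcap_(i in T) F i).
Proof.
move=> cT mF; rewrite -[X in measurable X]setCK setC_bigcap; apply: measurableC.
by apply: bigcup_countable_measurable => // i /mF; exact: measurableC.
Qed.

(** There are only countably many finite subsets of the countable set [J], so
    the value [T x] itself can serve as a label of [x]. *)
Lemma finite_values_countable_labels d (X : measurableType d) I (A : set X)
    (J : set I) (T : X -> set I) : countable J -> measurable A ->
    (forall i, J i -> measurable [set x | A x /\ T x i]) ->
    (forall x, A x -> T x `<=` J /\ finite_set (T x)) ->
  exists f : X -> nat, (forall k, measurable [set x | A x /\ f x = k]) /\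
    forall x y, A x -> A y -> f x = f y -> T x = T y.
Proof.
move=> cJ mA mT finT.
have /countable_injP[c cI] := countable_finite_subset cJ.
exists (c \o T); split; last first.
  by move=> x y /finT Tx /finT Ty /cI; apply; rewrite inE.
move=> k.
have [[S [[SJ fS] Sk]]|nS] :=
    pselect (exists S, (S `<=` J /\ finite_set S) /\ c S = k).
- have -> : [set x | A x /\ (c \o T) x = k] =
      A `&` \bigcap_(i in J) [set x | A x /\ (T x i <-> S i)].
    apply/seteqP; split=> x /= [Ax].
      move=> Tk; split => // i Ji; split => //.
      suff -> : T x = S by [].
      by apply: cI; rewrite ?inE //= ?Tk //; exact: finT.
    move=> TS; split => //; rewrite -Sk; congr c; apply/seteqP; split => i Ti.
      by have [_ [h _]] := TS i ((finT _ Ax).1 _ Ti); exact: h.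
    by have [_ [_ h]] := TS i (SJ _ Ti); exact: h.
  apply: measurableI => //; apply: bigcap_countable_measurable => // i Ji.
  have [Si|Si] := pselect (S i).
    have -> : [set x | A x /\ (T x i <-> S i)] = [set x | A x /\ T x i].
      by apply/seteqP; split => x /= [Ax]; [case=> _ h | move=> ?]; split; auto.
    exact: mT.
  have -> : [set x | A x /\ (T x i <-> S i)] = A `\` [set x | A x /\ T x i].
    apply/seteqP; split => x /= [Ax]; first by case=> h _; split => // -[_ /h].
    by move=> nT; split => //; split => // Ti; case: nT.
  by apply: measurableD => //; exact: mT.
- have -> : [set x | A x /\ (c \o T) x = k] = set0; last exact: measurable0.
  rewrite -subset0 => x /= [Ax Tk]; apply: nS; exists (T x); split => //.
  exact: finT.
Qed.

(** Preimages of a countable family of balls.  Each ball is replaced by its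
    interior, since balls of an abstract metric structure need not be open. *)
Lemma standard_borel_separating (R : realType) d (X : measurableType d) :
  standard_borel R X ->
  exists2 B : nat -> set X, (forall m, measurable (B m)) &
    forall x (F : set X), finite_set F -> ~ F x ->
      exists2 m, B m x & forall y, F y -> ~ B m y.
Proof.
move=> [P [S cS dS] [f bf mf]].
have [f_inj f_surj] : injective f /\ forall p, exists x, f x = p.
  case: bf => g fK gK; split; first exact: can_inj fK.
  by move=> p; exists (g p).
pose I := (S `*` [set: nat])%classic.
have cI : countable I by apply: countableX.
pose V (i : P * nat) : set P := (ball i.1 (i.2.+1%:R^-1 : R)%R)^°.
have mV i : measurable (f @^-1` V i).
  apply/mf; rewrite image_preimage; last first.
    by apply/seteqP; split => // p _; have [x <-] := f_surj p; exists x.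
  apply: sub_sigma_algebra; exact: open_interior.
have sepV x (F : set X) : finite_set F -> ~ F x ->
    exists2 i, I i /\ V i (f x) & forall y, F y -> ~ V i (f y).
  move=> finF nFx.
  have : nbhs (f x) (~` (f @` F)).
    apply: open_nbhs_nbhs; split; last first.
      by move=> [y Fy /f_inj yx]; apply: nFx; rewrite -yx.
    apply: closed_openC; apply: (accessible_finite_set_closed.1
      (hausdorff_accessible (@metric_hausdorff R P))).
    exact: finite_image.
  rewrite -nbhs_ballE => -[e /= e0 eF].
  have e2 : (0 < e / 2)%R by rewrite divr_gt0.
  have [n _ /(_ n (leqnn n)) /= ne] := near_infty_natSinv_lt (PosNum e2).
  pose r : R := (n.+1%:R^-1)%R.
  have r0 : (0 < r / 2)%R by rewrite divr_gt0 // invr_gt0.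
  have [q [/interior_subset xq Sq]] : (ball (f x) (r / 2)%R)^° `&` S !=set0.
    apply: dS; last exact: open_interior.
    by exists (f x); exact: nbhsx_ballx.
  exists (q, n).
    split => //; rewrite /V /= /interior.
    apply: filterS (nbhsx_ballx (f x) _ r0) => p xp.
    exact: ball_split (ball_sym xq) xp.
  move=> y Fy /interior_subset /= qy; apply: (eF (f y)); last by exists y.
  have := ball_triangle xq qy; apply: le_ball.
  rewrite (splitr e); apply: lerD; last exact: ltW.
  apply: le_trans (ltW ne); rewrite -/r ler_pdivrMr // ler_peMr ?ler1n //.
  by rewrite invr_ge0.
have /countable_injP[c cI'] := cI.
exists (fun k => \bigcup_(i in [set i | I i /\ c i = k]) f @^-1` V i).
  move=> k; apply: bigcup_countable_measurable => //.
  by apply: sub_countable cI; apply: subset_card_le => i [].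
move=> x F finF nFx; have [i [Ii Vi] nV] := sepV x F finF nFx.
exists (c i); first by exists i.
move=> y Fy [j [Ij /cI' ji] Vj]; apply: (nV y Fy).
by rewrite -ji ?inE.
Qed.

(** * Lacunary sets *)

Section Spaced.
Context {G : topologicalGroupType} {d : measure_display} {X : measurableType d}.
Variable act : G -> X -> X.
Local Open Scope group_scope.
Implicit Types (A C D : set X) (Q K U : set G).

(** For a free action and [Q] a neighborhood of [1] this is lacunarity, with
    [Q] in the role of [U^-1 U].  Unlike [lacunary_for] it makes sense for any
    set [Q] of forbidden displacements, such as a countable one. *)
Definition spaced Q A := forall x g, Q g -> A x -> A (act g x) -> g = 1.

Lemma sub_spaced Q Q' A A' : Q' `<=` Q -> A' `<=` A -> spaced Q A ->
  spaced Q' A'.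
Proof. by move=> QQ AA sA x g /QQ ? /AA ? /AA ?; exact: (sA x). Qed.

Hypothesis actP : group_action act.

Let act1 x : act 1 x = x. Proof. exact: actP.1. Qed.
Let actM g h x : act (g * h) x = act g (act h x). Proof. exact: actP.2. Qed.

Lemma actK g x : act g^-1 (act g x) = x.
Proof. by rewrite -actM mulVg act1. Qed.

Lemma actVK g x : act g (act g^-1 x) = x.
Proof. by rewrite -actM mulgV act1. Qed.

Lemma act_mulgV g h x : act (h * g^-1) (act g x) = act h x.
Proof. by rewrite actM actK. Qed.

Lemma lacunary_spaced A : free_action act -> lacunary act A ->
  exists2 Q, nbhs (1 : G) Q & spaced Q A.
Proof.
move=> fr [U U1 lU]; exists U => // x g Ug Ax Agx; apply: (fr g x).
apply: contrapT => gx.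
have /seteqP[+ _] := lU _ _ Agx Ax gx; apply; split.
  by exists 1; [exact: nbhs_singleton | exact: act1].
by exists g.
Qed.

Lemma spaced_lacunary Q A : nbhs (1 : G) Q -> spaced Q A -> lacunary act A.
Proof.
move=> /nbhs_sqrt[U [U1 UV UM]] sA; exists U => // x y Ax Ay xy.
rewrite -subset0 => _ [[g Ug <-] [h Uh hg]]; apply: xy.
have yx : y = act (h^-1 * g) x by rewrite actM -hg actK.
by rewrite yx (sA x (h^-1 * g)) -?yx //; apply: UM => //; exact: UV.
Qed.

(** Around any [g] there is a neighborhood that contains at most one visit. *)
Lemma spaced_closed_discrete Q A x : hausdorff_space G -> nbhs (1 : G) Q ->
  spaced Q A -> closed_discrete (visits act A x).
Proof.
move=> hG Q1 sA; have [U [U1 UV UM]] := nbhs_sqrt Q1.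
have eqv g h : visits act A x g -> visits act A x h -> Q (h^-1 * g) -> h = g.
  rewrite /visits /= => Ag Ah /(sA _ _)/(_ Ag).
  rewrite -actM mulgK => /(_ Ah)/(congr1 (fun k => h * k)).
  by rewrite mulVKg mulg1.
split.
  move=> g clg.
  have [h [vh Uh]] := clg _ (nbhs_ldivg g U1).
  suff -> : g = h by [].
  apply: contrapT => gh.
  have := hausdorff_accessible hG.
  move=> /accessible_closed_set1/(_ h)/closed_openC oh.
  have gnh : nbhs g (~` [set h]) by exact: open_nbhs_nbhs.
  have [k [vk [Uk kh]]] := clg _ (filterI (nbhs_ldivg g U1) gnh).
  apply: kh; apply: eqv => //.
  rewrite -(mulgK g k^-1) -mulgA; apply: UM => //.
  by have := UV _ Uh; rewrite /= invgM invgK.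
move=> g vg; split; first by rewrite inE.
exists [set h | Q (h^-1 * g)]; first exact: nbhs_ldivg.
apply/seteqP; split => [h [Qh vh]|h ->] /=; first exact: eqv.
by split => //=; rewrite mulVg; exact: nbhs_singleton.
Qed.

(** If the set were infinite, its cofinite subsets would cluster at some point
    of [K], but every point of [G] has a neighborhood with at most one element
    of the set. *)
Lemma spaced_compact_finite Q A K x : nbhs (1 : G) Q -> spaced Q A ->
  compact K -> finite_set [set g | K g /\ A (act g x)].
Proof.
move=> Q1 sA cK; set S := (X in finite_set X); apply: contrapT => infS.
have [U [U1 UV UM]] := nbhs_sqrt Q1.
pose F := [set B : set G | finite_set (S `\` B)].
have FF : ProperFilter F.
  split; first by rewrite /F /= setD0.
  split; first by rewrite /F /= setDT.
  - by move=> P P' FP FP'; rewrite /F /= setDIr finite_setU.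
  - by move=> P P' PP'; apply: sub_finite_set; exact: setDS.
have [|p [Kp clp]] := cK F FF.
  by rewrite /F /= (_ : S `\` K = set0) // -subset0 => g [[]].
have eqv g h : S g -> S h -> U (g * p^-1) -> U (h * p^-1) -> g = h.
  move=> [_ Ag] [_ Ah] Ug Uh; apply/divg1_eq/(sA (act h x)) => //.
    have := UM _ _ Ug (UV _ Uh); by rewrite invgF mulgA mulgVK.
  by rewrite act_mulgV.
have [h [Sh Uh]] : S `&` [set h | U (h * p^-1)] !=set0.
  apply: clp; last exact: nbhs_divg.
  by rewrite /F /= setDv.
have [k [[Sk kh] Uk]] : (S `\ h) `&` [set h | U (h * p^-1)] !=set0.
  apply: clp; last exact: nbhs_divg.
  rewrite /F /=; apply: sub_finite_set (finite_set1 h) => k [Sk nk].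
  by apply: contrapT => kh; apply: nk.
by apply: kh; exact: eqv.
Qed.

End Spaced.

(** * Maximal spaced sets *)

Section Maximal.
Context {G : topologicalGroupType} {d : measure_display} {X : measurableType d}.
Variable act : G -> X -> X.
Local Open Scope group_scope.
Implicit Types (A C D : set X) (Q K U : set G).

Hypothesis actP : group_action act.
Hypothesis fr : free_action act.
Hypothesis mact : forall g A, measurable A -> measurable [set x | A (act g x)].
Variable B : nat -> set X.
Hypothesis mB : forall m, measurable (B m).
Hypothesis sepB : forall x (F : set X), finite_set F -> ~ F x ->
  exists2 m, B m x & forall y, F y -> ~ B m y.

Lemma bigcup_act_measurable (T : set G) A : countable T -> measurable A ->
  measurable [set x | exists2 t, T t & A (act t x)].
Proof.
move=> cT mA; have := bigcup_countable_measurable cT (fun t _ => mact t mA).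
by congr measurable; apply/seteqP; split => x [t]; exists t.
Qed.

Fixpoint greedy (T : set G) (Y : nat -> set X) n : set X :=
  if n is m.+1 then
    greedy T Y m `|`
      (Y n `\` [set x | exists2 t, T t & greedy T Y m (act t x)])
  else Y 0%N.

Lemma greedy_maximal (T : set G) (Y : nat -> set X) : countable T ->
    (forall t, T t -> T t^-1) -> (forall n, measurable (Y n)) ->
    (forall n, spaced act T (Y n)) ->
  exists A, [/\ measurable A, Y 0%N `<=` A, A `<=` \bigcup_n Y n,
    spaced act T A
    & forall n x, Y n x -> A x \/ exists2 t, T t & A (act t x)].
Proof.
move=> cT TV mY sY; pose A := greedy T Y.
have AE n : A n.+1 = A n `|` (Y n.+1 `\`
  [set x | exists2 t, T t & A n (act t x)]) by [].
have mA n : measurable (A n).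
  elim: n => [|n IHn]; first exact: mY.
  rewrite AE; apply: measurableU => //; apply: measurableD => //.
  exact: bigcup_act_measurable.
have AS n m : A n `<=` A (m + n)%N.
  by elim: m => [|m IHm] x // /IHm Ax; rewrite addSn AE; left.
have sA n : spaced act T (A n).
  elim: n => [|n IHn]; first exact: sY.
  rewrite AE => x t Tt [Anx|[Yx nx]] [Antx|[Ytx ntx]].
  - exact: (IHn x).
  - by case: ntx; exists t^-1; [exact: TV | rewrite actK].
  - by case: nx; exists t.
  - exact: (sY n.+1 x).
exists (\bigcup_n A n); split.
- exact: bigcupT_measurable.
- by move=> x Yx; exists 0%N.
- move=> x [n _]; elim: n => [|n IHn]; first by exists 0%N.
  rewrite AE.
  by case=> [/IHn //|[]]; exists n.+1.
- move=> x t Tt [n _ An] [m _ Am]; apply: (sA (m + n)%N x) => //.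
    exact: AS.
  by rewrite addnC; exact: AS.
- move=> [|n] x Yx; first by left; exists 0%N.
  have [[t Tt At]|nT] := pselect (exists2 t, T t & A n (act t x)).
    by right; exists t => //; exists n.
  by left; exists n.+1 => //; rewrite AE; right.
Qed.

(** Since [Z i] is locally finite with respect to [T], each of its points is
    separated by some [B m] from its finitely many neighbors in [Z i].  Hence
    the points of [Z i] that lie in [B m] while their neighbors in [Z i] do not
    form countably many spaced Borel sets covering [Z i], and the greedy
    procedure applies to them, starting with [C]. *)
Lemma maximal_extension (T : set G) C (Z : nat -> set X) : countable T ->
    (forall t, T t -> T t^-1) -> measurable C -> spaced act T C ->
    (forall i, measurable (Z i)) ->
    (forall i x, finite_set [set t | T t /\ Z i (act t x)]) ->
  exists A, [/\ measurable A, C `<=` A, A `<=` C `|` \bigcup_i Z i,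
    spaced act T A
    & forall i x, Z i x -> A x \/ exists2 t, T t & A (act t x)].
Proof.
move=> cT TV mC sC mZ finZ.
pose T' := T `\ 1; have cT' : countable T'.
  by apply: sub_countable cT; apply: subset_card_le => t [].
pose piece i m := (Z i `&` B m) `\`
  [set x | exists2 t, T' t & (Z i `&` B m) (act t x)].
have mpiece i m : measurable (piece i m).
  by apply: measurableD; [|apply: bigcup_act_measurable => //];
    exact: measurableI.
have spiece i m : spaced act T (piece i m).
  move=> x t Tt [_ nx] [Zt _]; apply: contrapT => t1.
  by apply: nx; exists t.
pose Y n := if n is k.+1 then
    if unpickle k is Some im then piece im.1 im.2 else set0 else C.
have Yim i m : Y (pickle (i, m)).+1 = piece i m by rewrite /Y pickleK.
have [||A [mA CA AY sA maxA]] := @greedy_maximal T Y cT TV.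
- by case=> [|k] //=; case: unpickle.
- by case=> [|k] //=; case: unpickle => [im|x t _ []]; first exact: spiece.
exists A; split => //.
- move=> x /AY[[|k] _ /=]; first by left.
  by case: unpickle => [im [[Zx _] _]|[]]; right; exists im.1.
- move=> i x Zx.
  have [||m Bx nB] :=
    @sepB x [set act t x | t in T' `&` [set t | Z i (act t x)]].
  + apply: finite_image; apply: sub_finite_set (finZ i x) => t [[Tt _] Zt].
    by [].
  + by move=> [t [[_ t1] _]] /fr.
  apply: (maxA (pickle (i, m)).+1); rewrite Yim; split => // -[t T't [Zt Bt]].
  by apply: (nB (act t x)) => //; exists t.
Qed.

End Maximal.

(** * Syndetic sets and separating labels *)

Section Syndetic.
Context {G : topologicalGroupType} {d : measure_display} {X : measurableType d}.
Variable act : G -> X -> X.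
Local Open Scope group_scope.
Implicit Types (A C D : set X) (Q K U : set G).

Hypothesis actP : group_action act.
Hypothesis fr : free_action act.
Hypothesis mact : forall g A, measurable A -> measurable [set x | A (act g x)].
Variable B : nat -> set X.
Hypothesis mB : forall m, measurable (B m).
Hypothesis sepB : forall x (F : set X), finite_set F -> ~ F x ->
  exists2 m, B m x & forall y, F y -> ~ B m y.
Variable Gamma : set G.
Hypothesis cGamma : countable Gamma.
Hypothesis Gamma1 : Gamma 1.
Hypothesis GammaV : forall g, Gamma g -> Gamma g^-1.
Hypothesis GammaM : forall g h, Gamma g -> Gamma h -> Gamma (g * h).

Definition syndetic A :=
  exists2 K : set G, compact K & forall x, exists2 g, K g & A (act g x).

Definition displaced_in A := forall x g, A x -> A (act g x) -> Gamma g.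

Lemma displaced_translates C A : displaced_in C ->
  (forall x, A x -> exists2 g, Gamma g & C (act g x)) -> displaced_in A.
Proof.
move=> GC AC x g /AC[a Ga Cax] /AC[b Gb Cbgx].
have -> : g = b^-1 * ((b * g * a^-1) * a) by rewrite mulgVK mulKg.
apply: GammaM; [exact: GammaV | apply: GammaM => //].
by apply: (GC (act a x)); rewrite // act_mulgV // actP.2.
Qed.

(** Take a maximal extension of [C] by the translates of [C] under [Gamma].
    The union of these translates is dense in every orbit, so any [x] is moved
    into it by a small element, and then into [A] by another small element. *)
Lemma syndetic_extension C Q : hausdorff_space G ->
    locally_compact [set: G] -> dense Gamma -> measurable C ->
    (forall x, exists g, C (act g x)) ->
    displaced_in C -> nbhs (1 : G) Q -> spaced act Q C ->
  exists A, [/\ measurable A, C `<=` A, displaced_in A, syndetic A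
    & exists2 U, nbhs (1 : G) U & spaced act U A].
Proof.
move=> hG lG dG mC mtC GC Q1 sC.
have [K cK K1] := compact_nbhs1 lG.
have [U [U1 UV UM]] := nbhs_sqrt (filterI Q1 K1).
have UQK : U `<=` Q `&` K.
  by move=> g Ug; rewrite -(mulg1 g); apply: UM => //; exact: nbhs_singleton.
have UK : U `<=` K by move=> g /UQK[].
pose T := Gamma `&` U.
have [c cinj] : exists c : G -> nat, {in Gamma &, injective c}.
  exact/countable_injP.
pose Z i := [set x | exists2 g, (Gamma `&` [set g | c g = i]) g
  & C (act g^-1 x)].
have ZE g i : Gamma g -> c g = i -> Z i = [set x | C (act g^-1 x)].
  move=> Gg ci; apply/seteqP; split => x /=; last by exists g.
  by move=> [h [Gh hi]]; rewrite (cinj h g) ?inE // hi.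
have mZ i : measurable (Z i).
  have [[g [Gg gi]]|nZ] := pselect (exists g, Gamma g /\ c g = i).
    by rewrite (ZE g) //; exact: mact.
  rewrite (_ : Z i = set0) // -subset0 => x [g [Gg gi] _].
  by apply: nZ; exists g.
have finZ i x : finite_set [set t | T t /\ Z i (act t x)].
  have [[g [Gg gi]]|nZ] := pselect (exists g, Gamma g /\ c g = i); last first.
    rewrite (_ : [set _ | _] = set0) // -subset0 => t [_ [g [Gg gi] _]].
    by apply: nZ; exists g.
  rewrite (ZE g) //.
  have cgK : compact [set g^-1 * k | k in K].
    apply: continuous_compact cK; apply: continuous_subspaceT.
    exact: mulg_left_continuous.
  have := finite_image (fun h => g * h)
    (spaced_compact_finite actP x Q1 sC cgK).
  apply: sub_finite_set => t [[_ Ut] /=]; rewrite -actP.2 => Ct.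
  exists (g^-1 * t); rewrite ?mulVKg //; split => //.
  by exists t => //; exact: UK.
have [|t [Gt Ut]||A [mA CA AZ sA maxA]] :=
  @maximal_extension G d X act actP fr mact B mB sepB T C Z _ _ mC _ mZ finZ.
- by apply: sub_countable cGamma; apply: subset_card_le => t [].
- by split; [exact: GammaV | exact: UV].
- by apply: sub_spaced sC => // t [_ /UQK[]].
have GA : displaced_in A.
  apply: displaced_translates GC _ => x /AZ[Cx|[i _ [g [Gg _] Cx]]].
    by exists 1; rewrite ?actP.1.
  by exists g^-1 => //; exact: GammaV.
exists A; split => //; last first.
  exists U => // x g Ug Ax Agx; apply: (sA x) => //; split => //.
  exact: (GA x).
exists (K `|` [set p.1 * p.2 | p in K `*` K]).
  by apply: compactU => //; exact: compact_mulg.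
move=> x; have [g Cgx] := mtC x.
have [h Gh] := dense_nbhs dG (nbhs_divg g^-1 U1).
rewrite /= invgK => Uhg.
have Zx : Z (c h) (act (h * g) x).
  by rewrite (ZE h) //= -actP.2 mulKg.
have [Ax|[t [Gt Ut] Ax]] := maxA _ _ Zx.
  by exists (h * g) => //; left; exact: UK.
exists (t * (h * g)); last by rewrite actP.2.
by right; exists (t, h * g) => //; split => /=; exact: UK.
Qed.

Section Labels.
Variables (A : set X) (Q : set G).
Hypothesis mA : measurable A.
Hypothesis GA : displaced_in A.
Hypothesis Q1 : nbhs (1 : G) Q.
Hypothesis sA : spaced act Q A.

Definition large_part D := [/\ measurable D, D `<=` A & syndetic D].

(** As [G] is not compact, some [h] lies outside [K^-1].  For [x] in [D] some
    [g] in [K] brings [h x] back to [D], and [g * h] is not [1]; so each point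
    of [D] has another one at a displacement in the compact set [L].  Take for
    [E] a maximal subset of [D] without displacements in [L] and [L^-1]: by
    maximality [E] is syndetic, and next to a point of [E] there is a point of
    [D] that is not in [E]. *)
Lemma large_part_split D : ~ compact [set: G] -> large_part D ->
  exists E, [/\ E `<=` D, large_part E & large_part (D `\` E)].
Proof.
move=> ncG [mD DA [K cK synD]].
have [h nKh] : exists h, ~ K h^-1.
  apply: contrapT => nh; apply: ncG.
  rewrite (_ : [set: G] = [set g^-1 | g in K]); first exact: compact_invg.
  apply/seteqP; split => // g _; exists g^-1; rewrite ?invgK //.
  by apply: contrapT => ?; apply: nh; exists g.
pose L := [set k * h | k in K]; pose L' := L `|` [set g^-1 | g in L].
have cL' : compact L'.
  have cL : compact L by exact: compact_mulg_right.
  by apply: compactU => //; exact: compact_invg.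
pose T := Gamma `&` L'.
have [||||E [mE _ ED sE maxE]] := @maximal_extension G d X act actP fr mact B mB
  sepB T set0 (fun=> D) _ _ measurable0 _ (fun=> mD).
- by apply: sub_countable cGamma; apply: subset_card_le => t [].
- move=> t [Gt L't]; split; first exact: GammaV.
  by case: L't => [Lt|[g Lg <-]]; [right; exists t | left; rewrite invgK].
- by move=> x t _ [].
- move=> _ x; have := spaced_compact_finite actP x Q1 sA cL'.
  by apply: sub_finite_set => t [[_ ?] /DA].
have {}ED : E `<=` D by move=> x /ED[[]|[_ _]].
have near_D x : D x -> exists2 t, T t /\ t <> 1 & D (act t x).
  move=> Dx; have [g Kg Dgx] := synD (act h x).
  exists (g * h); last by rewrite actP.2.
  split; last by move=> /mulg1_eq gh; apply: nKh; rewrite -gh invgK.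
  split; first by apply: (GA (x := x)); [exact: DA | rewrite actP.2; exact: DA].
  by left; exists g.
pose M := K `|` [set p.1 * p.2 | p in L' `*` K].
have cM : compact M by apply: compactU => //; exact: compact_mulg.
have synM F : (forall x, D x -> F x \/ exists2 t, T t & F (act t x)) ->
    syndetic F.
  move=> DF; exists M => // x; have [g Kg Dgx] := synD x.
  have [Fgx|[t [_ Lt] Ftgx]] := DF _ Dgx; first by exists g => //; left.
  by exists (t * g); [right; exists (t, g) | rewrite actP.2].
exists E; split => //; split => //.
- exact: subset_trans DA.
- by apply: synM => x; exact: (maxE 0%N).
- exact: measurableD.
- by move=> x [/DA].
- apply: synM => x Dx; have [Ex|nEx] := pselect (E x); last by left.
  have [t [Tt t1] Dtx] := near_D _ Dx.
  by right; exists t => //; split => // Etx; apply: t1; exact: (sE x).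
Qed.

Lemma disjoint_large_parts : ~ compact [set: G] -> syndetic A ->
  exists2 E : nat -> set X, (forall n, large_part (E n)) &
    forall m n x, E m x -> E n x -> m = n.
Proof.
move=> ncG synA.
have [s sP] : {s : set X -> set X | forall D, large_part D ->
    [/\ s D `<=` D, large_part (s D) & large_part (D `\` s D)]}.
  exists (fun D => xget set0
    [set E | [/\ E `<=` D, large_part E & large_part (D `\` E)]]) => D lD.
  by case: xgetP => // nE; have [E /nE] := large_part_split ncG lD.
pose R n := iter n (fun D => D `\` s D) A.
have lR n : large_part (R n).
  by elim: n => [|n /sP[]] //; split.
have lt_disj m n x : (m < n)%N -> s (R m) x -> ~ R n x.
  move=> + sx; elim: n => // n IHn; rewrite ltnS leq_eqVlt => /orP[/eqP <-|mn].
    by move=> [].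
  by move=> [/(IHn mn)].
exists (s \o R) => [n|m n x sm sn]; first by have [] := sP _ (lR n).
have Rm : R m x by have [+ _ _] := sP _ (lR m); exact.
have Rn : R n x by have [+ _ _] := sP _ (lR n); exact.
by case: (ltngtP m n) => // [/lt_disj/(_ sm)|/lt_disj/(_ sn)].
Qed.

(** The value [T x] lists what a point [x] of [E n] has to record: the
    triple [(n, g, m)] says that [g . x] belongs to [A] and to [B m].  It is
    finite since [g^-1] ranges over the compact set [K n], and because [x] lies
    in one [E n] only. *)
Lemma separating_labels : ~ compact [set: G] -> syndetic A ->
  exists2 f : X -> nat, (forall k, measurable [set x | A x /\ f x = k]) &
    forall x y, A x -> A y -> (forall g, A (act g x) -> A (act g y)) ->
      (forall g, A (act g x) -> f (act g x) = f (act g y)) -> x = y.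
Proof.
move=> ncG synA; have [E lE disjE] := disjoint_large_parts ncG synA.
have /choice[K KP] : forall n, exists K : set G, compact K /\
    forall x, exists2 g, K g & E n (act g x).
  move=> n.
  by have [_ _ [K cK KE]] := lE n; exists K.
pose J : set (nat * G * nat) := [set: nat] `*` Gamma `*` [set: nat].
pose T x : set (nat * G * nat) := [set i | [/\ E i.1.1 x, J i,
  K i.1.1 i.1.2^-1 /\ (i.2 <= i.1.1)%N, A (act i.1.2 x) & B i.2 (act i.1.2 x)]].
have [||i Ji|x Ax|f [mf fT]] := @finite_values_countable_labels d X _ A J T.
- by apply: countableX => //; apply: countableX.
- exact: mA.
- have [Ki|nKi] := pselect (K i.1.1 i.1.2^-1 /\ (i.2 <= i.1.1)%N); last first.
    by rewrite (_ : [set _ | _] = set0) // -subset0 => x [_ []].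
  rewrite (_ : [set _ | _] =
      A `&` (E i.1.1 `&` [set x | (A `&` B i.2) (act i.1.2 x)])).
    apply: measurableI => //; apply: measurableI; first by have [] := lE i.1.1.
    by apply: mact; exact: measurableI.
  apply/seteqP; split => x /=; first by move=> [Ax []].
  by move=> [Ax [Ex [Agx Bgx]]].
- split; first by move=> i [].
  have [[n En]|nE] := pselect (exists n, E n x); last first.
    rewrite (_ : T x = set0) // -subset0 => i [Ei _ _ _ _].
    by apply: nE; exists i.1.1.
  have finK : finite_set [set g | [set k^-1 | k in K n] g /\ A (act g x)].
    apply: (spaced_compact_finite actP x Q1 sA).
    by apply: compact_invg; case: (KP n).
  have := finite_setX (finite_setX (finite_set1 n) finK) (finite_II n.+1).
  apply: sub_finite_set => -[[m g] k] [/= Em _ [Kg km] Ag _].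
  rewrite (disjE _ _ _ Em En) in Kg km *.
  by split => //; split => //=; split => //; exists g^-1; rewrite ?invgK.
exists f => // x y Ax Ay Axy fxy; apply: contrapT => xy.
have [m Bx nBy] := sepB (finite_set1 y) xy.
apply: (nBy y erefl).
(* the bit [B m x] is recorded at the point [act g x] of [E m] *)
have [_ /(_ x)[g Kg Egx]] := KP m.
have Agx : A (act g x) by have [_ + _] := lE m; exact.
have TE : T (act g x) = T (act g y).
  by apply: fT; [| exact: Axy | exact: fxy].
have : T (act g x) (m, g^-1, m).
  split => //=; rewrite ?invgK ?actK //.
  by split => //; split => //=; apply: GammaV; exact: (GA (x := x)).
by rewrite TE => -[_ _ _ _] /=; rewrite actK.
Qed.

End Labels.
End Syndetic.

(** * Coding labels by positions *)

Section Coding.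
Context {G : topologicalGroupType} {d : measure_display} {X : measurableType d}.
Variable act : G -> X -> X.
Local Open Scope group_scope.
Implicit Types (A C D : set X) (Q K U : set G).

Hypothesis actP : group_action act.
Hypothesis mact : forall g A, measurable A -> measurable [set x | A (act g x)].
Variable Gamma : set G.
Hypothesis Gamma1 : Gamma 1.
Hypothesis GammaV : forall g, Gamma g -> Gamma g^-1.
Hypothesis hG : hausdorff_space G.
Hypothesis ndG : ~ discrete_group G.
Hypothesis dG : dense Gamma.

(** Three scales: [delta] is small relative to [U], the elements of [N] are
    small relative to [delta], and the [gamma i] lie in [N] but outside the
    still smaller [W]. *)
Lemma gadgets U : nbhs (1 : G) U -> exists N W (delta : G) (gamma : nat -> G),
  [/\ [/\ nbhs (1 : G) W, W `<=` N, N `<=` U & U delta],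
      [/\ forall g, N g -> N g^-1, forall g, W g -> W g^-1
        & forall g h, N g -> N h -> g * h <> delta],
      Gamma delta, injective gamma
    & forall i, [/\ Gamma (gamma i), N (gamma i) & ~ W (gamma i)]].
Proof.
move=> U1; have [e e_inj eGU] := dense_nbhs_sequence hG ndG dG U1.
have [n en] : exists n, e n <> 1.
  have [e0|] := pselect (e 0%N = 1); last by exists 0%N.
  by exists 1%N; rewrite -e0 => /e_inj.
pose delta := e n; have [Gd Ud] := eGU n.
have [N [N1 NV NM]] := nbhs_sqrt (filterI U1 (nbhs_avoid hG en)).
have NU : N `<=` U.
  by move=> g Ng; rewrite -(mulg1 g);
    have [] := NM _ _ Ng (nbhs_singleton N1).
have [h Nh h1] := not_discrete_nbhs1 ndG (nbhs_interior N1).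
have [W [W1 WV WM]] := nbhs_sqrt (filterI N1 (nbhs_avoid hG h1)).
have WW g : W g -> N g.
  by move=> Wg; rewrite -(mulg1 g); have [] := WM _ _ Wg (nbhs_singleton W1).
have [gamma gammaI gammaP] := dense_nbhs_sequence hG ndG dG
  (filterI (Nh : nbhs h N) (nbhs_ldivg h W1)).
exists N, W, delta, gamma; split => //.
  split => // g k Ng Nk; by have [] := NM _ _ Ng Nk.
move=> i; have [Gi [Ni Wi]] := gammaP i; split => // Wgi.
by have [_] := WM _ _ Wgi Wi; rewrite /= mulVKg.
Qed.

(** Distinct elements of a triple [1], [delta], [gamma i] have their quotients
    outside [W], which makes [D] lacunary.  If [y], [delta y] and [gamma i y]
    all lie in [D], they lie in the triple of a single [c].  Then [y] is not
    [delta c], which has no other point of the triple at a displacement in [N];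
    nor is it [gamma (f c) c], whose displacements to the other two points
    differ from [delta].  So [y = c], and [i = f c] as [gamma] is injective. *)
Lemma coded_section A Q (f : X -> nat) : nbhs (1 : G) Q -> spaced act Q A ->
    measurable A -> (forall k, measurable [set x | A x /\ f x = k]) ->
  exists D (delta : G) (gamma : nat -> G),
    [/\ measurable D, A `<=` D,
        forall x, D x -> exists2 g, Gamma g & A (act g x),
        exists2 U, nbhs (1 : G) U & spaced act U D
      & forall x i, A x /\ f x = i <->
          [/\ D x, D (act delta x) & D (act (gamma i) x)]].
Proof.
move=> Q1 sA mA mf.
have [V [V1 VV VM]] := nbhs_sqrt Q1.
have [M [M1 MV MM]] := nbhs_sqrt V1.
have MQ a b c : M a -> M b -> M c -> Q (a * b * c).
  move=> Ma Mb Mc; apply: VM; first exact: MM.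
  by rewrite -(mulg1 c); apply: MM => //; exact: nbhs_singleton.
have [N [W [delta [gamma [[W1 WN NM Md] [NV WV NN] Gd gI gamP]]]]] :=
  gadgets M1.
have Gg i : Gamma (gamma i) by have [] := gamP i.
have Ng i : N (gamma i) by have [] := gamP i.
have nWg i : ~ W (gamma i) by have [] := gamP i.
have W_1 : W 1 by exact: nbhs_singleton.
have N_1 : N 1 by exact: WN.
have nNd : ~ N delta by move=> Nd; apply: (NN delta 1); rewrite ?mulg1.
have g1 i : gamma i <> 1 by move=> gi; apply: (nWg i); rewrite gi.
pose pat c (s : G) := [\/ s = 1, s = delta | s = gamma (f c)].
have patM c s : pat c s -> M s by case=> ->; [exact: NM | | exact: NM].
have patG c s : pat c s -> Gamma s by case=> ->.
pose D := A `|` [set x | A (act delta^-1 x)] `|`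
  \bigcup_i [set x | A (act (gamma i)^-1 x) /\ f (act (gamma i)^-1 x) = i].
have DP x : D x <-> exists c s, [/\ A c, pat c s & x = act s c].
  split.
    case=> [[Ax|Ax]|[i _ [Ax fx]]].
    - by exists x, 1; split => //; [constructor 1 | rewrite actP.1].
    - exists (act delta^-1 x), delta; split => //; last by rewrite actVK.
      by constructor 2.
    - exists (act (gamma i)^-1 x), (gamma i).
      by split => //; [constructor 3; rewrite fx | rewrite actVK].
  move=> [c [s [Ac ps ->]]]; case: ps => ->.
  - by left; left; rewrite actP.1.
  - by left; right; rewrite /= actK.
  - by right; exists (f c) => //=; rewrite actK.
(* points of [D] with displacement in [M] come from the same point of [A],
   as [A] has no displacements in [M^3] *)
have cluster c s g : A c -> pat c s -> M g -> D (act g (act s c)) ->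
    pat c (g * s).
  move=> Ac ps Mg /DP[c' [s' [Ac' ps']]]; rewrite -actP.2 => E.
  have E' : act (s'^-1 * g * s) c = c' by rewrite -mulgA actP.2 E actK.
  have s1 : s'^-1 * g * s = 1.
    apply: (sA c) => //; last by rewrite E'.
    by apply: MQ => //; [apply: MV; exact: patM ps' | exact: patM ps].
  have -> : g * s = s' by rewrite -[RHS]mulg1 -s1 -mulgA mulVKg.
  by move: E'; rewrite s1 actP.1 => ->.
exists D, delta, gamma; split.
- apply: measurableU; first by apply: measurableU => //; exact: mact.
  by apply: bigcupT_measurable => i; exact: (mact (gamma i)^-1 (mf i)).
- by move=> x Ax; left; left.
- move=> x /DP[c [s [Ac ps ->]]]; exists s^-1; rewrite ?actK //.
  exact/GammaV/(patG c).
- exists W => // x g Og /DP[c [s [Ac ps ->]]] /(cluster _ _ _ Ac ps).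
  have Ng' := NV _ (WN _ Og).
  move=> /(_ (NM _ (WN _ Og))); case: ps => ->; rewrite ?mulg1.
  + by case=> [//|gd|gg]; [case: nNd; rewrite -gd; exact: WN
                          | case: (nWg (f c)); rewrite -gg].
  + case=> [/mulg1_eq gd|gd|gd].
    * by case: nNd; rewrite -gd.
    * by apply: (mulIg delta); rewrite mul1g.
    * case: (NN g^-1 (gamma (f c))) => //; by rewrite -gd mulKg.
  + case=> [/mulg1_eq gg|gd|gg].
    * by case: (nWg (f c)); rewrite -gg; exact: WV.
    * by case: (NN _ _ (WN _ Og) (Ng (f c))).
    * by apply: (mulIg (gamma (f c))); rewrite mul1g.
- move=> x i; split.
    move=> [Ax fx]; split; first by left; left.
      by left; right; rewrite /= actK.
    by right; exists i => //=; rewrite actK.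
  move=> [/DP[c [s [Ac ps ->]]] /(cluster _ _ _ Ac ps Md) p1
          /(cluster _ _ _ Ac ps (NM _ (Ng i))) p2].
  case: ps p1 p2 => ->; rewrite ?mulg1.
  + move=> _; rewrite actP.1; case=> [/g1 //|gd|/gI -> //].
    by case: nNd; rewrite -gd.
  + move=> _; case=> [/mulg1_eq gd|gd|gd].
    * by case: nNd; rewrite -gd; exact: NV.
    * by case: (g1 i); apply: (mulIg delta); rewrite mul1g.
    * case: (NN (gamma i)^-1 (gamma (f c))) => //; first exact: NV.
      by rewrite -gd mulKg.
  + case=> [/mulg1_eq gd|gd|gd].
    * by case: nNd; rewrite -[delta]invgK gd; exact: NV.
    * by case: (g1 (f c)); apply: (mulgI delta); rewrite mulg1.
    * case: nNd; have -> : delta = 1; last by [].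
      by apply: (mulIg (gamma (f c))); rewrite mul1g.
Qed.

End Coding.

Theorem lemma2p1 (R : realType) (G : topologicalGroupType)
    (d : measure_display) (X : measurableType d) (act : G -> X -> X)
    (Gamma : set G) (C : set X) :
  hausdorff_space G ->
  locally_compact [set: G] ->
  @second_countable G ->
  ~ discrete_group G ->
  ~ compact [set: G] ->
  standard_borel R X ->
  group_action act ->
  free_action act ->
  borel_action act ->
  group_closed (mem Gamma) ->
  countable Gamma ->
  dense Gamma ->
  cross_section act C ->
  lacunary act C ->
  cocycle act @` orbit_equiv_on act C `<=` Gamma ->
  exists D : set X,
    [/\ cross_section act D,
        lacunary act D,
        separating act D,
        C `<=` D
      & cocycle act @` orbit_equiv_on act D `<=` Gamma].
Proof.
move=> hG lG _ ndG ncG sbX actP fr bact gcG cG dG [mC mtC _] lC coC.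
have Gamma1 : Gamma 1%g by have := gcG.1; rewrite inE.
have GammaV g : Gamma g -> Gamma (g^-1)%g.
  by move=> /mem_set/(group_closedV gcG); rewrite inE.
have GammaM g h : Gamma g -> Gamma h -> Gamma (g * h)%g.
  by move=> /mem_set Gg /mem_set/(group_closedM gcG Gg); rewrite inE.
have mact g (A : set X) : measurable A -> measurable [set x | A (act g x)].
  move=> mA.
  have := measurable_fun_pair2 (g : borel_group G) bact measurableT mA.
  by rewrite setTI.
have coP (D : set X) : cocycle act @` orbit_equiv_on act D `<=` Gamma <->
    displaced_in act Gamma D.
  split=> [coD x g Dx Dgx|GD _ [[x y] [[g /= <-] [/= Dx Dgx]] <-]].
    rewrite -(cocycle_unique actP fr g x); apply: coD.
    by exists (x, act g x) => //; split => //; exists g.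
  by rewrite cocycle_unique //; exact: (GD x).
have [B mB sepB] := standard_borel_separating sbX.
have [Q Q1 sC] := lacunary_spaced actP fr lC.
have [|A [mA CA GA synA [U U1 sA]]] := syndetic_extension actP fr mact mB sepB
    cG Gamma1 GammaV GammaM hG lG dG mC _ ((coP C).1 coC) Q1 sC.
  by move=> x; have [y Cy [g /= gx]] := mtC x; exists g; rewrite gx.
have [f mf fsep] := separating_labels actP fr mact mB sepB cG GammaV
    mA GA U1 sA ncG synA.
have [D [delta [gamma [mD AD DA [W W1 sD] DE]]]] :=
  coded_section actP mact Gamma1 GammaV hG ndG dG U1 sA mA mf.
exists D; split.
- split=> // x; last exact: (spaced_closed_discrete actP x hG W1 sD).
  by have [y /CA/AD Dy yx] := mtC x; exists y.
- exact: (spaced_lacunary actP W1 sD).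
- move=> x y /seteqP[xy yx].
  have Dxy g : D (act g x) -> D (act g y).
    by move=> Dgx; have := xy g^-1%g; rewrite /visits /= invgK; apply.
  have Exy g i : A (act g x) /\ f (act g x) = i ->
      A (act g y) /\ f (act g y) = i.
    by rewrite !DE -!actP.2 => -[]; split; exact: Dxy.
  (* it suffices to compare the points over a visit to [A], where the labels
     determine the point *)
  have [g Ax] : exists g, A (act g x).
    by have [z /CA Az [g /= gx]] := mtC x; exists g; rewrite gx.
  suff : act g x = act g y by move/(congr1 (act g^-1%g)); rewrite !actK.
  have Axy h : A (act h (act g x)) -> A (act h (act g y)) /\
      f (act h (act g y)) = f (act h (act g x)).
    by rewrite -!actP.2 => Ah; apply: Exy.
  apply: fsep => //.
  + by have [] := Exy g _ (conj Ax erefl).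
  + by move=> h /Axy[].
  + by move=> h /Axy[_ ->].
- by move=> x /CA /AD.
- by apply/coP; exact: (displaced_translates actP GammaV GammaM GA DA).
Qed.
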